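(* Let $A$ be an affine Poisson algebra over $\mathbb{C}$. (i) Let $M$ be a finite-dimensional simple Poisson $A$-module and let $J=\operatorname{ann}_A(M)$. There is a simple module $M^*$ for the Lie algebra $\mathfrak{g}(J)=J/J^2$ such that $M^*=M$, as $\mathbb{C}$-vector spaces, and $[j+J^2,m]_{M^*}=\{j,m\}_M$ for all $j\in J$ and $m\in M$. (ii) Let $J$ be a Poisson maximal ideal of $A$ and let $N$ be a finite-dimensional simple $\mathfrak{g}(J)$-module. There exist a simple Poisson $A$-module $N^\dagger$ and a Lie homomorphism $f:A\to\mathfrak{g}(J)$ such that $N^\dagger={}^{f}N$ as a Lie module over $A$ and $\operatorname{ann}_A(N^\dagger)=J$. (iii) For all finite-dimensional simple Poisson $A$-modules $M$, $M^{*\dagger}=M$. For all Poisson maximal ideals $J$ of $A$ and all finite-dimensional simple $\mathfrak{g}(J)$-modules $N$, $N^{\dagger *}=N$. (iv) The procedures in (i) and (ii) establish a bijection $\Gamma$ from the set of isomorphism classes of finite-dimensional simple Poisson modules over $A$ to the set of pairs $(J,\widehat{N})$, where $J$ is a Poisson maximal ideal of $A$ and $N$ is a finite-dimensional simple $\mathfrak{g}(J)$-module, given by $\Gamma(\widehat{M})=(\operatorname{ann}_A(M),\widehat{M^*})$.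
   Context: The base field is $\mathbb{C}$. A Poisson algebra is a commutative $\mathbb{C}$-algebra $A$ with a bilinear product $\{-,-\}$ making $A$ a Lie algebra and such that $\{a,-\}$ is a $\mathbb{C}$-derivation of $A$ for each $a\in A$. It is affine if it is finitely generated as a $\mathbb{C}$-algebra. An ideal $I$ is a Poisson ideal if $\{i,a\}\in I$ for all $i\in I$, $a\in A$. A Poisson maximal ideal is a maximal ideal of $A$ that is also a Poisson ideal. If $J$ is a Poisson ideal then so is $J^2$, and $\mathfrak{g}(J):=J/J^2$ is a Lie algebra under the bracket induced by $\{-,-\}$. A Poisson $A$-module is an $A$-module $M$ with a bilinear product $\{-,-\}_M:A\times M\to M$ such that for all $a,b\in A$, $m\in M$: (1) $\{\{a,b\},m\}_M=\{a,\{b,m\}_M\}_M-\{b,\{a,m\}_M\}_M$; (2) $\{a,bm\}_M=\{a,b\}m+b\{a,m\}_M$; (3) $\{ab,m\}_M=a\{b,m\}_M+b\{a,m\}_M$. By (1), $M$ is in particular a module over $A$ viewed as a Lie algebra. A Poisson submodule is an $A$-submodule $N$ with $\{a,n\}_M\in N$ for all $a\in A$, $n\in N$; a nonzero Poisson module $M$ is simple if its only Poisson submodules are $0$ and $M$. A Poisson module isomorphism is a bijective $A$-module homomorphism $g:M\to M'$ with $g(\{a,m\}_M)=\{a,g(m)\}_{M'}$ for all $a\in A$, $m\in M$. $\operatorname{ann}_A(M)=\{a\in A: aM=0\}$. Finite-dimensional means of finite dimension over $\mathbb{C}$. For a Lie algebra $\mathfrak{g}$, a $\mathfrak{g}$-module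 $N$ has its action written $[-,-]_N:\mathfrak{g}\times N\to N$. If $f:\mathfrak{g}\to\mathfrak{h}$ is a Lie algebra homomorphism and $N$ is an $\mathfrak{h}$-module, ${}^fN$ denotes the $\mathfrak{g}$-module with underlying space $N$ and action $[a,n]_{{}^fN}=[f(a),n]_N$. $\widehat{M}$ denotes the isomorphism class of a finite-dimensional simple Poisson $A$-module $M$ (as Poisson module), and $\widehat{N}$ the isomorphism class of a finite-dimensional simple Lie module $N$. Notation used in (iii) and (iv) only: there $N^\dagger$ stands for the particular module obtained by the procedure that proves (ii), namely the space $N$ with $A$-action $a\cdot n=\pi_{\mathbb{C}}(a)n$ and $\{a,n\}_{N^\dagger}=[\pi_J(a)+J^2,n]_N$, where $\pi_{\mathbb{C}}$ and $\pi_J$ are the projections of $A=\mathbb{C}\oplus J$ (as vector spaces) onto $\mathbb{C}$ and $J$. Part (ii) itself asserts only existence. *)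

(* Defs.v *)
From HB Require Import structures.
From mathcomp Require Import all_boot all_order all_algebra.
From mathcomp Require Import generic_quotient ring_quotient.
From mathcomp Require Import boolp classical_sets reals complex.

Set Implicit Arguments.
Unset Strict Implicit.
Unset Printing Implicit Defensive.

Import GRing.Theory.
Local Open Scope ring_scope.
Local Open Scope quotient_scope.

HB.mixin Record isLieAlgebra (K : fieldType) L of GRing.Lmodule K L := {
  lie : L -> L -> L;
  lie_linearl : forall y, linear (lie^~ y);
  lie_linearr : forall x, linear (lie x);
  liexx : forall x, lie x x = 0;
  lie_jacobi : forall x y z,
    lie x (lie y z) + lie y (lie z x) + lie z (lie x y) = 0
}.

#[short(type="lieAlgType")]
HB.structure Definition LieAlgebra (K : fieldType) :=
  {L of isLieAlgebra K L & GRing.Lmodule K L}.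

(* The underlying ring is a [ComPzRing]: the zero algebra is allowed. *)
HB.mixin Record isPoissonAlgebra (K : fieldType) A
    of GRing.ComPzRing A & GRing.Algebra K A & LieAlgebra K A := {
  lie_leibniz : forall a b c : A, lie a (b * c) = lie a b * c + b * lie a c
}.

#[short(type="poissonAlgType")]
HB.structure Definition PoissonAlgebra (K : fieldType) :=
  {A of isPoissonAlgebra K A & GRing.ComPzRing A & GRing.Algebra K A
      & LieAlgebra K A}.

(* Some finite sequence is contained in no proper subalgebra. *)
Definition affine (K : fieldType) (A : poissonAlgType K) : Prop :=
  exists s : seq A, forall S : {pred A},
    GRing.subalg_closed S -> {subset s <= S} -> forall a, a \in S.

Section LieTheory.
Variables (K : fieldType) (L : lieAlgType K).
Implicit Types (x y z : L) (c : K).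

Lemma lieDl x y z : lie (x + y) z = lie x z + lie y z.
Proof. by have := lie_linearl z 1 x y; rewrite /= !scale1r. Qed.
Lemma lieDr x y z : lie x (y + z) = lie x y + lie x z.
Proof. by have := lie_linearr x 1 y z; rewrite /= !scale1r. Qed.
Lemma lie0l x : lie 0 x = 0.
Proof. by apply: (addrI (lie 0 x)); rewrite -lieDl !addr0. Qed.
Lemma lie0r x : lie x 0 = 0.
Proof. by apply: (addrI (lie x 0)); rewrite -lieDr !addr0. Qed.
Lemma lieZl c x y : lie (c *: x) y = c *: lie x y.
Proof. by have := lie_linearl y c x 0; rewrite /= lie0l !addr0. Qed.
Lemma lieZr c x y : lie x (c *: y) = c *: lie x y.
Proof. by have := lie_linearr x c y 0; rewrite /= lie0r !addr0. Qed.
Lemma lieC x y : lie x y = - lie y x.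
Proof.
apply/eqP; rewrite -addr_eq0; apply/eqP.
by have := liexx (x + y); rewrite lieDl !lieDr !liexx add0r addr0.
Qed.
Lemma lieNl x y : lie (- x) y = - lie x y.
Proof. by rewrite -scaleN1r lieZl scaleN1r. Qed.
Lemma lieNr x y : lie x (- y) = - lie x y.
Proof. by rewrite -scaleN1r lieZr scaleN1r. Qed.
Lemma lieBl x y z : lie (x - y) z = lie x z - lie y z.
Proof. by rewrite lieDl lieNl. Qed.
Lemma lieBr x y z : lie x (y - z) = lie x y - lie x z.
Proof. by rewrite lieDr lieNr. Qed.

End LieTheory.

Record lieHom (K : fieldType) (L L' : lieAlgType K) := LieHom {
  lieHom_fun :> {linear L -> L'};
  lieHomP : forall x y, lieHom_fun (lie x y) = lie (lieHom_fun x) (lieHom_fun y)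
}.

(* A Lie module structure on a given vector space. *)
Record lieModule (K : fieldType) (L : lieAlgType K) (V : lmodType K) :=
  LieModule {
    lact :> L -> V -> V;
    lact_linearl : forall v, linear (lact^~ v);
    lact_linearr : forall x, linear (lact x);
    lactP : forall x y v,
      lact (lie x y) v = lact x (lact y v) - lact y (lact x v)
}.

(* A Poisson module structure on a given vector space; linearity of the
   A-action in A, together with [pact1], makes the vector space structure the
   one induced by the A-module structure. *)
Record poissonModule (K : fieldType) (A : poissonAlgType K) (V : lmodType K) :=
  PoissonModule {
    pact : A -> V -> V;
    pbr : A -> V -> V;
    pact_linearl : forall v, linear (pact^~ v);
    pact_linearr : forall a, linear (pact a);
    pact1 : forall v, pact 1 v = v;
    pactM : forall a b v, pact (a * b) v = pact a (pact b v);
    pbr_linearl : forall v, linear (pbr^~ v);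
    pbr_linearr : forall a, linear (pbr a);
    pbr_lie : forall a b v, pbr (lie a b) v = pbr a (pbr b v) - pbr b (pbr a v);
    pbr_act : forall a b v, pbr a (pact b v) = pact (lie a b) v + pact b (pbr a v);
    pbrM : forall a b v, pbr (a * b) v = pact a (pbr b v) + pact b (pbr a v)
}.

Section LieModuleTheory.
Variables (K : fieldType) (L : lieAlgType K) (V : lmodType K) (N : lieModule L V).

Lemma lact0 x : N x 0 = 0.
Proof.
by have := lact_linearr N x (-1) 0 0; rewrite scaler0 addr0 scaleN1r addNr.
Qed.
Lemma lact0l v : N 0 v = 0.
Proof.
by have := lact_linearl N v (-1) 0 0; rewrite /= scaler0 addr0 scaleN1r addNr.
Qed.

End LieModuleTheory.

Section Modules.
Variables (K : fieldType).

Definition lie_simple (L : lieAlgType K) (V : vectType K) (N : lieModule L V) :=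
  (exists v : V, v != 0) /\
  forall U : {vspace V}, (forall x u, u \in U -> N x u \in U) ->
    U = 0%VS \/ U = fullv.

Definition poisson_simple (A : poissonAlgType K) (V : vectType K)
    (M : poissonModule A V) :=
  (exists v : V, v != 0) /\
  forall U : {vspace V},
    (forall a u, u \in U -> pact M a u \in U) ->
    (forall a u, u \in U -> pbr M a u \in U) ->
    U = 0%VS \/ U = fullv.

Definition lie_iso (L : lieAlgType K) (V V' : lmodType K)
    (N : lieModule L V) (N' : lieModule L V') : Prop :=
  exists g : {linear V -> V'},
    bijective g /\ forall x v, g (N x v) = N' x (g v).

Definition poisson_iso (A : poissonAlgType K) (V V' : lmodType K)
    (M : poissonModule A V) (M' : poissonModule A V') : Prop :=
  exists g : {linear V -> V'},
    [/\ bijective g,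
        forall a v, g (pact M a v) = pact M' a (g v)
      & forall a v, g (pbr M a v) = pbr M' a (g v)].

Definition lie_of_poisson (A : poissonAlgType K) (V : lmodType K)
    (M : poissonModule A V) : lieModule A V :=
  LieModule (pbr_linearl M) (pbr_linearr M) (pbr_lie M).

Section Pullback.
Variables (L L' : lieAlgType K) (V : lmodType K).
Variables (f : lieHom L L') (N : lieModule L' V).

Let plact x v := N (f x) v.
Let plact_linearl v : linear (plact^~ v).
Proof. by move=> c x y; rewrite /plact linearP; apply: lact_linearl. Qed.
Let plactP x y v : plact (lie x y) v = plact x (plact y v) - plact y (plact x v).
Proof. by rewrite /plact lieHomP lactP. Qed.

Definition lie_pullback : lieModule L V :=
  LieModule plact_linearl (fun x => lact_linearr N (f x)) plactP.
End Pullback.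

End Modules.

Section Ideals.
Variables (K : fieldType) (A : poissonAlgType K).
Implicit Types I : {pred A}.

Definition ideal I : Prop :=
  [/\ 0 \in I, {in I &, forall x y, x + y \in I}
    & forall a, {in I, forall x, a * x \in I}].

Definition maximal_ideal I : Prop :=
  [/\ ideal I, 1 \notin I
    & forall I' : {pred A}, ideal I' -> 1 \notin I' ->
        {subset I <= I'} -> {subset I' <= I}].

Definition poisson_ideal I : Prop :=
  ideal I /\ forall i a, i \in I -> lie i a \in I.

Record poissonIdeal := PoissonIdeal {
  pideal :> {pred A};
  pidealP : poisson_ideal pideal
}.

Variable J : poissonIdeal.

Lemma pideal_submod_closed : GRing.submod_closed (pideal J).
Proof.
have [[J0 JD JM] _] := pidealP J; split=> // c x y xJ yJ.
by apply: JD => //; rewrite -mulr_algl; apply: JM.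
Qed.
HB.instance Definition _ :=
  GRing.isSubmodClosed.Build K A (pideal J) pideal_submod_closed.

Lemma pidealMr a x : x \in J -> a * x \in J.
Proof. by case: (pidealP J) => -[_ _ JM] _; apply: JM. Qed.
Lemma pideal_liel i a : i \in J -> lie i a \in J.
Proof. by case: (pidealP J) => _; apply. Qed.
Lemma pideal_lier a i : i \in J -> lie a i \in J.
Proof. by move=> iJ; rewrite lieC rpredN; apply: pideal_liel. Qed.

Record ideal_elt := IdealElt { ideal_val :> A; _ : ideal_val \in pideal J }.
HB.instance Definition _ := [isSub for ideal_val].
HB.instance Definition _ := [Choice of ideal_elt by <:].
HB.instance Definition _ := [SubChoice_isSubLmodule of ideal_elt by <:].

Definition square_spec (x : A) : Prop :=
  exists2 s : seq (A * A), {in s, forall p, p.1 \in J /\ p.2 \in J}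
                         & x = \sum_(p <- s) p.1 * p.2.

(* J^2, as a subset of J *)
Definition ideal_square : {pred ideal_elt} :=
  [pred x : ideal_elt | `[< square_spec (val x) >]].

Lemma square_specD x y : square_spec x -> square_spec y -> square_spec (x + y).
Proof.
move=> [s sJ ->] [t tJ ->]; exists (s ++ t); last by rewrite big_cat.
by move=> p; rewrite mem_cat => /orP[/sJ|/tJ].
Qed.
Lemma square_specM a x : square_spec x -> square_spec (a * x).
Proof.
move=> [s sJ ->]; exists [seq (a * p.1, p.2) | p <- s].
  by move=> _ /mapP[p /sJ[? ?] ->]; split=> //=; apply: pidealMr.
by rewrite big_map mulr_sumr; apply: eq_bigr => p _; rewrite mulrA.
Qed.
Lemma square_spec_mul x y : x \in J -> y \in J -> square_spec (x * y).
Proof.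
move=> xJ yJ; exists [:: (x, y)]; last by rewrite big_seq1.
by move=> p; rewrite inE => /eqP ->.
Qed.
Lemma square_spec0 : square_spec 0.
Proof. by exists [::]; rewrite ?big_nil. Qed.
Lemma square_spec_lier a x : square_spec x -> square_spec (lie a x).
Proof.
move=> [s sJ ->]; elim: s sJ => [|p s IHs] sJ.
  by rewrite big_nil lie0r; apply: square_spec0.
rewrite big_cons lieDr; apply: square_specD; last first.
  by apply: IHs => q qs; apply: sJ; rewrite inE qs orbT.
have [pJ1 pJ2] := sJ p (mem_head _ _).
rewrite lie_leibniz.
by apply: square_specD; apply: square_spec_mul => //; apply: pideal_lier.
Qed.

Lemma square_spec_lieB (a a' b b' : A) :
  square_spec (a' - a) -> square_spec (b' - b) ->
  square_spec (lie a' b' - lie a b).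
Proof.
move=> Ha Hb; rewrite (_ : _ - _ = lie a' (b' - b) + -1 * lie b (a' - a)).
  by apply/square_specD; last apply: square_specM; apply: square_spec_lier.
by rewrite mulN1r -(lieC (a' - a)) lieBl lieBr addrA addrNK.
Qed.

Lemma ideal_square_submod_closed : GRing.submod_closed ideal_square.
Proof.
split=> [|c x y]; rewrite !inE; first by rewrite raddf0; apply: square_spec0.
move=> Hx Hy; rewrite linearP.
by apply: square_specD => //=; rewrite -mulr_algl; apply: square_specM.
Qed.
HB.instance Definition _ := GRing.isSubmodClosed.Build K ideal_elt ideal_square
  ideal_square_submod_closed.

Definition cotangent : Type := {ideal_quot ideal_square}.
HB.instance Definition _ := GRing.Zmodule.on cotangent.

(* j |-> j + J^2 *)
Definition cotangent_class (j : ideal_elt) : cotangent :=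
  \pi_{ideal_quot ideal_square} j.

Lemma cotangent_classB : {morph cotangent_class : x y / x - y}.
Proof. exact: raddfB. Qed.
Lemma cotangent_classD : {morph cotangent_class : x y / x + y}.
Proof. exact: raddfD. Qed.

Lemma cotangent_class_eqP x y :
  reflect (cotangent_class x = cotangent_class y) (x - y \in ideal_square).
Proof. by rewrite Quotient.idealrBE; apply: eqP. Qed.

Lemma cotangent_reprK x : cotangent_class (repr x) = x.
Proof. exact: reprK. Qed.

Lemma cotangent_repr j : repr (cotangent_class j) - j \in ideal_square.
Proof. by apply/cotangent_class_eqP; rewrite cotangent_reprK. Qed.

Definition cotangent_scale (c : K) (x : cotangent) : cotangent :=
  cotangent_class (c *: repr x).

Lemma cotangent_scaleE c j :
  cotangent_scale c (cotangent_class j) = cotangent_class (c *: j).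
Proof.
by apply/cotangent_class_eqP; rewrite -scalerBr rpredZ // cotangent_repr.
Qed.

Lemma cotangent_scaleA c d x :
  cotangent_scale c (cotangent_scale d x) = cotangent_scale (c * d) x.
Proof. by rewrite -(cotangent_reprK x) !cotangent_scaleE scalerA. Qed.
Lemma cotangent_scale1 : left_id 1 cotangent_scale.
Proof. by move=> x; rewrite -(cotangent_reprK x) cotangent_scaleE scale1r. Qed.
Lemma cotangent_scaleDr : right_distributive cotangent_scale +%R.
Proof.
move=> c x y; rewrite -(cotangent_reprK x) -(cotangent_reprK y).
by rewrite -cotangent_classD !cotangent_scaleE -cotangent_classD scalerDr.
Qed.
Lemma cotangent_scaleDl x : {morph cotangent_scale^~ x : c d / c + d}.
Proof.
move=> c d /=; rewrite -(cotangent_reprK x) !cotangent_scaleE.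
by rewrite -cotangent_classD scalerDl.
Qed.
HB.instance Definition _ := GRing.Zmodule_isLmodule.Build K cotangent
  cotangent_scaleA cotangent_scale1 cotangent_scaleDr cotangent_scaleDl.

Lemma cotangent_class_linear : linear cotangent_class.
Proof.
move=> c x y; rewrite cotangent_classD; congr (_ + _).
by rewrite -cotangent_scaleE.
Qed.
HB.instance Definition _ := GRing.isLinear.Build K ideal_elt cotangent *:%R
  cotangent_class cotangent_class_linear.

Definition ideal_lie (x y : ideal_elt) : ideal_elt :=
  IdealElt (pideal_liel (ideal_val y) (valP x)).

Definition cotangent_lie (x y : cotangent) : cotangent :=
  cotangent_class (ideal_lie (repr x) (repr y)).

Lemma cotangent_lieE i j :
  cotangent_lie (cotangent_class i) (cotangent_class j) =
  cotangent_class (ideal_lie i j).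
Proof.
apply/cotangent_class_eqP; rewrite inE raddfB /=.
have := cotangent_repr j; have := cotangent_repr i.
rewrite !inE !raddfB /=; exact: square_spec_lieB.
Qed.

Lemma cotangent_lie_linearl y : linear (cotangent_lie^~ y).
Proof.
move=> c x x'; rewrite -(cotangent_reprK x) -(cotangent_reprK x') /=.
rewrite -(cotangent_reprK y) -linearP !cotangent_lieE -linearP; congr (_ _).
by apply: val_inj; rewrite /= lieDl lieZl.
Qed.
Lemma cotangent_lie_linearr x : linear (cotangent_lie x).
Proof.
move=> c y y'; rewrite -(cotangent_reprK y) -(cotangent_reprK y') /=.
rewrite -(cotangent_reprK x) -linearP !cotangent_lieE -linearP; congr (_ _).
by apply: val_inj; rewrite /= lieDr lieZr.
Qed.
Lemma cotangent_liexx x : cotangent_lie x x = 0.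
Proof.
rewrite -(cotangent_reprK x) cotangent_lieE -[RHS](raddf0 cotangent_class).
by congr (_ _); apply: val_inj; rewrite /= liexx.
Qed.
Lemma cotangent_lie_jacobi x y z :
  cotangent_lie x (cotangent_lie y z) + cotangent_lie y (cotangent_lie z x)
  + cotangent_lie z (cotangent_lie x y) = 0.
Proof.
rewrite -(cotangent_reprK x) -(cotangent_reprK y) -(cotangent_reprK z).
rewrite !cotangent_lieE -!raddfD -[RHS](raddf0 cotangent_class).
by congr (_ _); apply: val_inj; rewrite /= lie_jacobi.
Qed.
HB.instance Definition _ := isLieAlgebra.Build K cotangent cotangent_lie_linearl
  cotangent_lie_linearr cotangent_liexx cotangent_lie_jacobi.

Lemma lie_cotangent_class i j :
  lie (cotangent_class i) (cotangent_class j) = cotangent_class (ideal_lie i j).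
Proof. exact: cotangent_lieE. Qed.

End Ideals.

Section ModuleTheory.
Variables (K : fieldType) (A : poissonAlgType K) (V : lmodType K).
Variables (M : poissonModule A V).

Lemma pactD a v w : pact M a (v + w) = pact M a v + pact M a w.
Proof. by have := pact_linearr M a 1 v w; rewrite !scale1r. Qed.
Lemma pact0 a : pact M a 0 = 0.
Proof. by apply: (addrI (pact M a 0)); rewrite -pactD !addr0. Qed.
Lemma pactDl a b v : pact M (a + b) v = pact M a v + pact M b v.
Proof. by have := pact_linearl M v 1 a b; rewrite /= !scale1r. Qed.
Lemma pact0l v : pact M 0 v = 0.
Proof. by apply: (addrI (pact M 0 v)); rewrite -pactDl !addr0. Qed.
Lemma pactNl a v : pact M (- a) v = - pact M a v.
Proof. by apply/eqP; rewrite -addr_eq0 -pactDl addNr pact0l. Qed.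
Lemma pbrD a v w : pbr M a (v + w) = pbr M a v + pbr M a w.
Proof. by have := pbr_linearr M a 1 v w; rewrite !scale1r. Qed.
Lemma pbr0 a : pbr M a 0 = 0.
Proof. by apply: (addrI (pbr M a 0)); rewrite -pbrD !addr0. Qed.
Lemma pbrDl a b v : pbr M (a + b) v = pbr M a v + pbr M b v.
Proof. by have := pbr_linearl M v 1 a b; rewrite /= !scale1r. Qed.
Lemma pbr0l v : pbr M 0 v = 0.
Proof. by apply: (addrI (pbr M 0 v)); rewrite -pbrDl !addr0. Qed.

Definition ann_pred : {pred A} := [pred a | `[< forall v, pact M a v = 0 >]].

Lemma ann_poisson_ideal : poisson_ideal ann_pred.
Proof.
split; first split.
- by apply/asboolP => v; rewrite pact0l.
- move=> a b /asboolP Ha /asboolP Hb; apply/asboolP => v.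
  by rewrite pactDl Ha Hb addr0.
- by move=> a b /asboolP Hb; apply/asboolP => v; rewrite pactM Hb pact0.
- move=> i a /asboolP Hi; apply/asboolP => v.
  rewrite lieC pactNl; have := pbr_act M a i v.
  by rewrite !Hi pbr0 addr0 => <-; rewrite oppr0.
Qed.

Definition ann : poissonIdeal A := PoissonIdeal ann_poisson_ideal.

Lemma annP (j : ideal_elt ann) v : pact M j v = 0.
Proof. by have /asboolP := valP j; apply. Qed.

Definition star_act (x : cotangent ann) (v : V) : V := pbr M (repr x : ideal_elt ann) v.

Lemma star_actE (j : ideal_elt ann) v : star_act (cotangent_class j) v = pbr M j v.
Proof.
rewrite /star_act; have /asboolP := cotangent_repr j.
move: (repr _) => i; rewrite raddfB /= => -[s sJ].
move/eqP; rewrite subr_eq => /eqP ->; rewrite pbrDl -[RHS]add0r; congr (_ + _).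
elim: s sJ => [|p s IHs] sJ; first by rewrite big_nil pbr0l.
have [/asboolP H1 /asboolP H2] := sJ p (mem_head _ _).
rewrite big_cons pbrDl IHs => [|q qs]; last by apply: sJ; rewrite inE qs orbT.
by rewrite pbrM H1 H2 !addr0.
Qed.

Lemma star_linearl v : linear (star_act^~ v).
Proof.
move=> c x y; rewrite -(cotangent_reprK x) -(cotangent_reprK y) -linearP.
by rewrite !star_actE; apply: pbr_linearl.
Qed.
Lemma star_linearr x : linear (star_act x).
Proof. exact: pbr_linearr. Qed.
Lemma starP x y v :
  star_act (lie x y) v = star_act x (star_act y v) - star_act y (star_act x v).
Proof.
rewrite -(cotangent_reprK x) -(cotangent_reprK y) lie_cotangent_class !star_actE.
exact: pbr_lie.
Qed.

(* M^*, the module with [j + J^2, v] = {j, v} (see [starE]), J = ann M. *)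
Definition star : lieModule (cotangent ann) V :=
  LieModule star_linearl star_linearr starP.

Lemma starE (j : ideal_elt ann) v : star (cotangent_class j) v = pbr M j v.
Proof. exact: star_actE. Qed.

End ModuleTheory.

Section Dagger.
Variables (K : fieldType) (A : poissonAlgType K) (J : poissonIdeal A).

(* A is the direct sum of K and J as a vector space *)
Definition splits : Prop := forall a : A, exists! c : K, a - c%:A \in J.

Variables (AJ : splits).

Definition projK (a : A) : K := projT1 (cid (AJ a)).
Lemma projJ_subproof (a : A) : a - (projK a)%:A \in pideal J.
Proof. by rewrite /projK; case: cid => c []. Qed.
Definition projJ (a : A) : ideal_elt J := IdealElt (projJ_subproof a).

Lemma projKP a c : a - c%:A \in J -> projK a = c.
Proof. by rewrite /projK; case: cid => d /= [_ Hd] /Hd. Qed.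
Lemma proj_decomp a : a = (projK a)%:A + (projJ a : A).
Proof. by rewrite /= addrC subrK. Qed.

Lemma projJ_mem a : (projJ a : A) \in J.
Proof. exact: projJ_subproof. Qed.

Lemma projKD_J (c : K) (x : A) : x \in J -> projK (c%:A + x) = c.
Proof. by move=> xJ; apply: projKP; rewrite addrAC subrr add0r. Qed.

Lemma projK_linear c a b : projK (c *: a + b) = c * projK a + projK b.
Proof.
rewrite {1}(proj_decomp a) {1}(proj_decomp b) scalerDr addrACA scalerA -scalerDl.
by apply: projKD_J; rewrite rpredD ?rpredZ ?projJ_mem.
Qed.

Lemma mul_decomp a b : a * b = (projK a * projK b)%:A
  + (projK a *: (projJ b : A) + projK b *: (projJ a : A)
     + (projJ a : A) * (projJ b : A)).
Proof.
rewrite {1}(proj_decomp a) {1}(proj_decomp b); move: (projJ a : A) (projJ b : A).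
move=> x y; rewrite mulrDl mulr_algl mulrDr mulr_algr scalerDr scalerA.
by rewrite -!addrA.
Qed.

Lemma projKM a b : projK (a * b) = projK a * projK b.
Proof.
by rewrite mul_decomp projKD_J // !rpredD ?rpredZ ?pidealMr ?projJ_mem.
Qed.

Lemma projK1 : projK 1 = 1.
Proof. by apply: projKP; rewrite scale1r subrr rpred0. Qed.

Lemma projJ_linear c a b : projJ (c *: a + b) = c *: projJ a + projJ b.
Proof.
apply: val_inj; rewrite /= projK_linear scalerBr addrACA scalerA -opprD.
by rewrite -scalerDl.
Qed.

Lemma projJM a b : cotangent_class (projJ (a * b)) =
  projK a *: cotangent_class (projJ b) + projK b *: cotangent_class (projJ a).
Proof.
rewrite -[_ *: cotangent_class _]linearZ -[projK b *: _]linearZ.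
rewrite -cotangent_classD; apply/cotangent_class_eqP.
rewrite inE raddfB /= projKM mul_decomp.
rewrite [X in X - _ - _]addrC addrK [X in X - _]addrC addrK.
by apply: square_spec_mul; apply: projJ_subproof.
Qed.

Lemma lie_scalar (a : A) (c : K) : lie a c%:A = 0.
Proof.
rewrite lieZr (_ : lie a 1 = 0) ?scaler0 //; apply: (addrI (lie a 1)).
by rewrite addr0 -[in RHS](mulr1 1) lie_leibniz mulr1 mul1r.
Qed.

Lemma lie_decomp a b : lie a b = lie (projJ a : A) (projJ b : A).
Proof.
rewrite /= lieBl !lieBr !lie_scalar !subr0.
by rewrite (lieC (projK a)%:A) lie_scalar oppr0 subr0.
Qed.

Lemma projK_lie a b : projK (lie a b) = 0.
Proof.
apply: projKP; rewrite scale0r subr0 lie_decomp.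
by apply: pideal_liel; apply: projJ_subproof.
Qed.

Lemma projJ_lie a b : projJ (lie a b) = ideal_lie (projJ a) (projJ b).
Proof.
by apply: val_inj; rewrite /= projK_lie scale0r subr0 lie_decomp.
Qed.

Variables (V : lmodType K) (N : lieModule (cotangent J) V).

Definition dagger_act (a : A) (n : V) : V := projK a *: n.
Definition dagger_br (a : A) (n : V) : V := N (cotangent_class (projJ a)) n.

Lemma dagger_act_linearl n : linear (dagger_act^~ n).
Proof. by move=> c a b; rewrite /dagger_act projK_linear scalerDl scalerA. Qed.
Lemma dagger_act_linearr a : linear (dagger_act a).
Proof.
by move=> c m n; rewrite /dagger_act scalerDr !scalerA mulrC.
Qed.
Lemma dagger_act1 n : dagger_act 1 n = n.
Proof. by rewrite /dagger_act projK1 scale1r. Qed.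
Lemma dagger_actM a b n : dagger_act (a * b) n = dagger_act a (dagger_act b n).
Proof. by rewrite /dagger_act projKM scalerA. Qed.
Lemma dagger_br_linearl n : linear (dagger_br^~ n).
Proof.
by move=> c a b; rewrite /dagger_br projJ_linear linearP; apply: lact_linearl.
Qed.
Lemma dagger_br_linearr a : linear (dagger_br a).
Proof. exact: lact_linearr. Qed.
Lemma dagger_br_lie a b n :
  dagger_br (lie a b) n = dagger_br a (dagger_br b n) - dagger_br b (dagger_br a n).
Proof. by rewrite /dagger_br projJ_lie -lie_cotangent_class lactP. Qed.
Lemma dagger_br_act a b n : dagger_br a (dagger_act b n) =
  dagger_act (lie a b) n + dagger_act b (dagger_br a n).
Proof.
rewrite /dagger_act projK_lie scale0r add0r /dagger_br.
by have := lact_linearr N (cotangent_class (projJ a)) (projK b) n 0; rewrite lact0 !addr0.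
Qed.
Lemma dagger_brM a b n : dagger_br (a * b) n =
  dagger_act a (dagger_br b n) + dagger_act b (dagger_br a n).
Proof.
rewrite /dagger_br projJM lact_linearl; congr (_ + _).
by have := lact_linearl N n (projK b) (cotangent_class (projJ a)) 0; rewrite /= lact0l !addr0.
Qed.

(* N^dagger, for the action a.n = pi_K(a) n and the bracket
   {a, n} = [pi_J(a) + J^2, n], where A = K + J. *)
Definition dagger : poissonModule A V :=
  PoissonModule dagger_act_linearl dagger_act_linearr dagger_act1 dagger_actM
    dagger_br_linearl dagger_br_linearr dagger_br_lie dagger_br_act dagger_brM.

End Dagger.

Section IsoClasses.
Variable K : fieldType.

Record fdSimpleLieModule (L : lieAlgType K) := FdSimpleLieModule {
  fdslm_space : vectType K;
  fdslm_module :> lieModule L fdslm_space;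
  fdslm_simple : lie_simple fdslm_module
}.

Record fdSimplePoissonModule (A : poissonAlgType K) := FdSimplePoissonModule {
  fdspm_space : vectType K;
  fdspm_module :> poissonModule A fdspm_space;
  fdspm_simple : poisson_simple fdspm_module
}.

(* Isomorphism classes are predicates rather than MathComp-Analysis [set]s,
   whose universe is too small to contain predicates on bundled modules. *)
Definition lie_class (L : lieAlgType K) (V : vectType K) (N : lieModule L V) :
  fdSimpleLieModule L -> Prop := fun N' => lie_iso N N'.

Definition poisson_class (A : poissonAlgType K) (V : vectType K)
    (M : poissonModule A V) :
  fdSimplePoissonModule A -> Prop := fun M' => poisson_iso M M'.

Definition poisson_classes (A : poissonAlgType K) : Type :=
  {c : fdSimplePoissonModule A -> Prop |
    exists M : fdSimplePoissonModule A, c = poisson_class M}.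

Definition class_of (A : poissonAlgType K) (M : fdSimplePoissonModule A) :
    poisson_classes A :=
  exist _ (poisson_class M) (ex_intro _ M erefl).

(* Pairs of a Poisson maximal ideal J and an isomorphism class of
   finite-dimensional simple modules over J/J^2. *)
Definition maximal_pairs (A : poissonAlgType K) : Type :=
  {p : {J : poissonIdeal A & fdSimpleLieModule (cotangent J) -> Prop} |
    maximal_ideal (projT1 p) /\
    exists N : fdSimpleLieModule (cotangent (projT1 p)), projT2 p = lie_class N}.

End IsoClasses.

(* Main.v *)
From HB Require Import structures.
Require Import Defs.
From mathcomp Require Import all_boot all_order all_algebra.
From mathcomp Require Import boolp classical_sets cardinality reals.
From mathcomp Require Import ereal complex.
From mathcomp Require Import lebesgue_measure.
From mathcomp Require Import finmap.

Set Implicit Arguments.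
Unset Strict Implicit.
Unset Printing Implicit Defensive.

Import GRing.Theory Num.Theory.
Local Open Scope ring_scope.
Local Open Scope complex_scope.

(** The whole correspondence rests on one fact: in all the situations at hand
    A = K + J as a vector space, where J is the Poisson ideal involved and
    K = C.  Once A splits in this way, giving a Poisson module annihilated by J
    is the same as giving a module over J/J^2: the A-action is forced to be
    a.v = pi_K(a) v, the bracket kills scalars by the Leibniz rule, and it
    kills J^2 because J annihilates the module.  The two constructions are then
    inverse to each other on the nose, they have the same invariant subspaces,
    and isomorphisms correspond; this is [dagger_star], [star_dagger],
    [star_simple], [dagger_simple] and, for the classes, [lie_pair_eqP].

    The splitting has two sources.

    For a finite-dimensional simple Poisson module M it says that A acts on M
    by scalars ([simple_scalar]).  The commuting operators of A have a common
    eigenvector, of weight chi say.  Its weight space is a Poisson submodule as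
    soon as chi vanishes on brackets, hence it is M.  Now if p is a nonzero
    polynomial with p(a) in J = ann M, then applying the derivation {b,-} and
    multiplying by {b,a} repeatedly replaces p by its derivatives, until a
    nonzero constant remains: a power of {b,a} lies in J ([lie_radical]).
    So {b,a} acts nilpotently, and chi({b,a}) = 0.

    For a maximal ideal J of an affine algebra it is the weak Nullstellensatz.
    Over the uncountable field C there is a short proof
    ([weak_nullstellensatz]): A has countable dimension, whereas if no x - c
    were in J, the inverses of the x - c modulo J would form an uncountable
    family, so finitely many of them would be linearly dependent, and clearing
    denominators would make x algebraic modulo J. *)

(** * The weak Nullstellensatz over an uncountable field *)

Lemma vectors_dependent (K : fieldType) (V : vectType K) n (W : 'I_n -> V) :
    (\dim {:V} < n)%N ->
  exists2 k : 'I_n -> K, (exists i, k i != 0) & \sum_i k i *: W i = 0.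
Proof.
move=> lt_Vn; apply: contrapT => no_k.
have W_free : free [tuple W i | i < n].
  apply/freeP => k k0 i; apply: contrapT => /eqP ki; apply: no_k.
  exists k; first by exists i.
  by rewrite -[RHS]k0; apply: eq_bigr => j _; rewrite -tnth_nth tnth_mktuple.
move: W_free; rewrite /free size_tuple => /eqP dimW.
by have := dimvS (subvf <<[tuple W i | i < n]>>%VS); rewrite dimW leqNgt lt_Vn.
Qed.

(** A countable subset of the reals has Lebesgue measure zero, and the unit
    interval does not. *)
Lemma complex_uncountable (R : realType) : ~ countable [set: R[i]].
Proof.
move=> /countable_injP[f f_inj].
have : countable [set` `[(0 : R), 1]].
  apply/countable_injP; exists (fun x : R => f x%:C) => x y _ _ /f_inj.
  by rewrite !in_setT => /(_ isT isT) [].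
move/countable_lebesgue_measure0.
rewrite lebesgue_measure_itv /= lte_fin ltr01 oppr0 adde0.
by move=> /eqP; rewrite eqe oner_eq0.
Qed.

Section AffineAlgebras.
Variables (K : fieldType) (A : poissonAlgType K).
Implicit Types (L : seq A) (a b x : A).

(** Stated on sequences because A may be infinite-dimensional. *)
Definition in_span L a : Prop :=
  exists k : nat -> K, a = \sum_(i < size L) k i *: L`_i.

Lemma in_spanD L a b : in_span L a -> in_span L b -> in_span L (a + b).
Proof.
move=> [k ->] [l ->]; exists (fun i => k i + l i).
by rewrite -big_split; apply: eq_bigr => i _; rewrite scalerDl.
Qed.

Lemma in_spanZ L c a : in_span L a -> in_span L (c *: a).
Proof.
move=> [k ->]; exists (fun i => c * k i); rewrite scaler_sumr.
by apply: eq_bigr => i _; rewrite scalerA.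
Qed.

Lemma in_span0 L : in_span L 0.
Proof. by exists (fun=> 0); rewrite big1 // => i _; rewrite scale0r. Qed.

Lemma mem_in_span L a : a \in L -> in_span L a.
Proof.
move=> aL; exists (fun i => (i == index a L)%:R).
have lt_aL : (index a L < size L)%N by rewrite index_mem.
rewrite (bigD1 (Ordinal lt_aL)) //= eqxx scale1r nth_index // big1 ?addr0 // => i.
by rewrite -val_eqE /= => /negPf ->; rewrite scale0r.
Qed.

Lemma in_span_ind (P : A -> Prop) L :
    P 0 -> (forall a b, P a -> P b -> P (a + b)) ->
    (forall c a, P a -> P (c *: a)) -> (forall a, a \in L -> P a) ->
  forall a, in_span L a -> P a.
Proof.
move=> P0 PD PZ PL _ [k ->]; elim/big_ind: _ => // i _.
by apply/PZ/PL/mem_nth.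
Qed.

(** An exhaustion of the subalgebra generated by s.  Since 1 is in every level,
    the levels increase; multiplying two elements costs one level. *)
Definition level (s : seq A) n : seq A :=
  iter n (fun L => [seq x * y | x <- L, y <- L]) (1 :: s).

Lemma level_one s n : 1 \in level s n.
Proof.
elim: n => [|n IHn]; first exact: mem_head.
by apply/allpairsP; exists (1, 1); rewrite /= mulr1.
Qed.

Lemma level_mono s m n : (m <= n)%N -> {subset level s m <= level s n}.
Proof.
elim: n => [|n IHn]; first by rewrite leqn0 => /eqP ->.
rewrite leq_eqVlt ltnS => /predU1P[-> // | /IHn sub_mn] a /sub_mn a_n.
by apply/allpairsP; exists (a, 1); rewrite /= mulr1 level_one.
Qed.

Lemma in_span_level_mono s m n a : (m <= n)%N ->
  in_span (level s m) a -> in_span (level s n) a.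
Proof.
move=> /(@level_mono s) sub_mn; move: a; apply: in_span_ind.
- exact: in_span0.
- exact: in_spanD.
- exact: in_spanZ.
- by move=> a /sub_mn; apply: mem_in_span.
Qed.

Lemma in_span_levelM s n a b : in_span (level s n) a ->
  in_span (level s n) b -> in_span (level s n.+1) (a * b).
Proof.
move=> a_n b_n; move: a a_n; apply: in_span_ind.
- by rewrite mul0r; apply: in_span0.
- by move=> a a' Ha Ha'; rewrite mulrDl; apply: in_spanD.
- by move=> c a Ha; rewrite -scalerAl; apply: in_spanZ.
move=> a a_n; move: b b_n; apply: in_span_ind.
- by rewrite mulr0; apply: in_span0.
- by move=> b b' Hb Hb'; rewrite mulrDr; apply: in_spanD.
- by move=> c b Hb; rewrite -scalerAr; apply: in_spanZ.
by move=> b b_n; apply/mem_in_span/allpairsP; exists (a, b).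
Qed.

(** An affine algebra has countable dimension. *)
Lemma affine_levels : affine A ->
  exists s : seq A, forall a, exists n, in_span (level s n) a.
Proof.
move=> [s gen_s]; exists s => a.
pose S := [pred x | `[< exists n, in_span (level s n) x >]].
suff /asboolP : a \in S by [].
apply: gen_s; last first.
  move=> x xs; apply/asboolP; exists 0%N; apply: mem_in_span.
  by rewrite inE xs orbT.
split=> [|c x y /asboolP[m Hx] /asboolP[n Hy]|
          x y /asboolP[m Hx] /asboolP[n Hy]];
  apply/asboolP.
- by exists 0%N; apply/mem_in_span/mem_head.
- exists (maxn m n); apply: in_spanD.
    by apply/in_spanZ/(in_span_level_mono _ Hx)/leq_maxl.
  by apply: (in_span_level_mono _ Hy); apply: leq_maxr.
- exists (maxn m n).+1; apply: in_span_levelM.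
    by apply: (in_span_level_mono _ Hx); apply: leq_maxl.
  by apply: (in_span_level_mono _ Hy); apply: leq_maxr.
Qed.

Lemma in_span_dependent L n (y : 'I_n -> A) : (size L < n)%N ->
    (forall i, in_span L (y i)) ->
  exists2 k : 'I_n -> K, (exists i, k i != 0) & \sum_i k i *: y i = 0.
Proof.
move=> lt_Ln /choice[w yE].
have dimL : \dim {:'rV[K]_(size L)} = size L by rewrite dimvf /dim /= mul1n.
rewrite -dimL in lt_Ln.
have [k k_neq0 k0] :=
  vectors_dependent (fun i => \row_(j < size L) w i j) lt_Ln.
exists k => //; under eq_bigr do rewrite yE scaler_sumr.
rewrite exchange_big big1 //= => j _.
under eq_bigr do rewrite scalerA; rewrite -scaler_suml.
have /rowP/(_ j) := k0; rewrite summxE mxE => k0j.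
rewrite [X in X *: _](_ : _ = 0) ?scale0r // -[RHS]k0j.
by apply: eq_bigr => i _; rewrite !mxE.
Qed.

(** Otherwise x and J would generate a larger proper ideal. *)
Lemma maximal_ideal_inverse (J : {pred A}) x : maximal_ideal J -> x \notin J ->
  exists y, x * y - 1 \in J.
Proof.
move=> [[J0 JD JM] _ Jmax] xNJ.
pose I := [pred z | `[< exists2 y, z - x * y \in J & True >]].
have [|oneNI] := boolP (1 \in I).
  case/asboolP=> y Hy _; exists y.
  by have := JM (-1) _ Hy; rewrite mulN1r opprB.
case/negP: xNJ; apply: (Jmax I) => //.
- split.
  + by apply/asboolP; exists 0; rewrite // mulr0 subr0.
  + move=> z z' /asboolP[y Hy _] /asboolP[y' Hy' _]; apply/asboolP.
    by exists (y + y'); rewrite // mulrDr opprD addrACA JD.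
  + move=> a z /asboolP[y Hy _]; apply/asboolP; exists (a * y) => //.
    by rewrite mulrCA -mulrBr JM.
- by move=> z zJ; apply/asboolP; exists 0; rewrite // mulr0 subr0.
- by apply/asboolP; exists 1; rewrite // mulr1 subrr.
Qed.

Lemma maximal_ideal_prime (J : {pred A}) x y : maximal_ideal J ->
  x * y \in J -> x \notin J -> y \in J.
Proof.
move=> Jmax xyJ /(maximal_ideal_inverse Jmax)[z Hz].
have [[J0 JD JM] _ _] := Jmax.
have -> : y = z * (x * y) + - y * (x * z - 1).
  by rewrite mulrBr mulr1 opprK mulNr (mulrC z) -mulrA mulrCA addNKr.
by apply: JD; apply: JM.
Qed.

Lemma horner_alg_prod a (rs : seq K) :
  horner_alg a (\prod_(r <- rs) ('X - r%:P)) = \prod_(r <- rs) (a - r%:A).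
Proof.
rewrite rmorph_prod; apply: eq_bigr => r _.
by rewrite rmorphB /= horner_algX horner_algC.
Qed.

End AffineAlgebras.

Section Nullstellensatz.
Variables (K : closedFieldType) (A : poissonAlgType K).

(** p splits into linear factors and J is prime. *)
Lemma maximal_ideal_algebraic (J : {pred A}) x (p : {poly K}) :
  maximal_ideal J -> p != 0 -> horner_alg x p \in J ->
  exists c : K, x - c%:A \in J.
Proof.
move=> Jmax p_neq0; have [[_ _ JM] J1 _] := Jmax.
have [rs ->] := closed_field_poly_normal p; rewrite linearZ /= horner_alg_prod.
move/(JM ((lead_coef p)^-1)%:A).
rewrite !mulr_algl scalerA mulVf ?lead_coef_eq0 // scale1r.
elim: rs => [|r rs IHrs]; first by rewrite big_nil (negPf J1).
rewrite big_cons; have [|xNJ] := boolP (x - r%:A \in J); first by exists r.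
by move=> H; apply: IHrs; apply: maximal_ideal_prime H xNJ.
Qed.

(** Suppose that no x - c is in J, and let y c invert x - c modulo J.  By
    uncountability infinitely many of the y c lie in the span of one single
    finite level, so some of them satisfy a linear relation with coefficients
    k i.  Multiplied by the product of the x - c i, it becomes a polynomial
    relation q for x modulo J, and q is nonzero because its value at c i is
    k i times the product of the c i - c j. *)
Lemma weak_nullstellensatz (J : {pred A}) : ~ countable [set: K] ->
  affine A -> maximal_ideal J -> forall x, exists c : K, x - c%:A \in J.
Proof.
move=> Kunc /affine_levels[s sP] Jmax x; apply: contrapT => noc.
have [[J0 JD JM] J1 _] := Jmax.
have /choice[y yP] c : exists y, (x - c%:A) * y - 1 \in J.
  by apply: maximal_ideal_inverse => //; apply/negP => ?; case: noc; exists c.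
have /choice[d dP] c : exists n, in_span (level s n) (y c) by apply: sP.
have [n Fn_inf] : exists n, infinite_set [set c | d c = n].
  apply: contrapT => Ffin; apply: Kunc.
  have -> : ([set: K] = \bigcup_(n in [set: nat]) [set c | d c = n])%classic.
    by apply/seteqP; split=> // c _; exists (d c).
  apply: bigcup_countable => [|n _]; first exact: countableP.
  by apply: finite_set_countable; apply: contrapT => ?; apply: Ffin; exists n.
have [C CF sizeC] := infinite_set_fset (size (level s n)).+1 Fn_inf.
pose c (i : 'I_(size C)) := tnth (in_tuple (C : seq K)) i.
have c_inj : injective c by apply/tuple_uniqP; rewrite /= fset_uniq.
have cn i : in_span (level s n) (y (c i)).
  have := CF (c i); rewrite /= mem_tnth => /(_ isT) <-; exact: dP.
have [k [i0 ki0] k0] := in_span_dependent sizeC cn.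
pose q := \sum_i k i *: \prod_(j | j != i) ('X - (c j)%:P).
have q_neq0 : q != 0.
  apply: contra_neq ki0 => q0; have := congr1 (fun p => p.[c i0]) q0.
  rewrite horner0 horner_sum (bigD1 i0) //=.
  rewrite [X in _ + X]big1 ?addr0 => [|i i_neq]; last first.
    rewrite hornerZ horner_prod (bigD1 i0) ?[i0 == _]eq_sym //=.
    by rewrite hornerXsubC subrr mul0r mulr0.
  rewrite hornerZ horner_prod => /eqP; rewrite mulf_eq0 => /orP[/eqP //|].
  rewrite prodf_seq_eq0 => /hasP[j _ /andP[j_neq]].
  rewrite hornerXsubC subr_eq0 => /eqP/c_inj/eqP.
  by rewrite eq_sym (negPf j_neq).
apply/noc/(maximal_ideal_algebraic Jmax q_neq0).
pose pi i := \prod_(j | j != i) (x - (c j)%:A).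
have -> : horner_alg x q = \sum_i k i *: pi i.
  rewrite linear_sum; apply: eq_bigr => i _.
  rewrite linearZ /= mulr_algl rmorph_prod; congr (_ *: _); apply: eq_bigr => j _.
  by rewrite rmorphB /= horner_algX horner_algC.
have -> : \sum_i k i *: pi i
    = \sum_i (- k i)%:A * pi i * ((x - (c i)%:A) * y (c i) - 1).
  apply/eqP; rewrite -subr_eq0 -sumrB; apply/eqP.
  transitivity ((\prod_i (x - (c i)%:A)) * \sum_i k i *: y (c i)).
    rewrite mulr_sumr; apply: eq_bigr => i _.
    rewrite (bigD1 i) //= mulr_algl scaleNr mulNr opprK mulrBr mulr1.
    rewrite addrC subrK -scalerAl -scalerAr mulrCA; congr (_ *: _).
    by rewrite -/(pi i) mulrA.
  by rewrite k0 mulr0.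
by apply: (big_ind (fun z => z \in J)) => // i _; apply: JM.
Qed.

End Nullstellensatz.

(** * Finite-dimensional simple Poisson modules have scalar action *)

Section RadicalDerivation.
Variables (K : numFieldType) (A : poissonAlgType K).
Implicit Types (a b y : A) (p : {poly K}).

Lemma lie_horner_alg b a p :
  lie b (horner_alg a p) = horner_alg a p^`() * lie b a.
Proof.
elim/poly_ind: p => [|p c IHp]; first by rewrite deriv0 !rmorph0 lie0r mul0r.
rewrite derivD derivM derivX derivC mulr1 addr0 !rmorphD !rmorphM /=.
rewrite horner_algX horner_algC lieDr lie_scalar addr0 lie_leibniz IHp.
by rewrite mulrDl mulrAC.
Qed.

Lemma lie_expr b y e : lie b (y ^+ e) * y = y ^+ e * (lie b y *+ e).
Proof.
elim: e => [|e IHe].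
  by rewrite expr0 -(scale1r 1) lie_scalar mul0r mulr0n mulr0.
rewrite exprS lie_leibniz mulrDl -[y * _ * y]mulrA IHe mulrS mulrDr !mulrA.
by congr (_ + _); rewrite mulrC -mulrA [lie b y * _]mulrC.
Qed.

(** The proof is by induction on the degree of p, for the more general
    hypothesis p(a) y^e in J with y = {b,a}: bracketing with b and multiplying
    by y gives p'(a) y^(e+2) in J, the other term of the Leibniz rule being a
    multiple of p(a) y^e. *)
Lemma lie_radical (J : poissonIdeal A) a b p : p != 0 ->
  horner_alg a p \in J -> exists n, lie b a ^+ n \in J.
Proof.
move=> p_neq0 pJ; set y := lie b a.
have {pJ} : horner_alg a p * y ^+ 0 \in J by rewrite expr0 mulr1.
move: {-1}(size p) (leqnn (size p)) 0%N => n.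
elim: n p p_neq0 => [|n IHn] p p_neq0 le_pn e peJ.
  by rewrite leqn0 size_poly_eq0 (negPf p_neq0) in le_pn.
have [le_p1|lt_1p] := leqP (size p) 1.
  exists e; have [c c_neq0 pc] : exists2 c, c != 0 & p = c%:P.
    by apply/size_poly1P; rewrite eqn_leq le_p1 lt0n size_poly_eq0.
  have -> : y ^+ e = (c^-1)%:A * (horner_alg a p * y ^+ e).
    by rewrite pc horner_algC !mulr_algl scalerA mulVf // scale1r.
  exact: pidealMr.
apply: (IHn p^`() _ _ e.+2).
- have p_lead : p`_(size p).-1 != 0 by rewrite -lead_coefE lead_coef_eq0.
  apply: contra_neq p_lead => p'0; have := coef_deriv p (size p).-2.
  rewrite p'0 coef0 => /esym/eqP; rewrite mulrn_eq0 /= => /eqP.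
  by rewrite (_ : (size p).-2.+1 = (size p).-1) //; case: (size p) lt_1p => [|[]].
- by rewrite -ltnS (leq_trans _ le_pn) // lt_size_deriv.
have -> : horner_alg a p^`() * y ^+ e.+2
    = y * lie b (horner_alg a p * y ^+ e)
      - (lie b y *+ e) * (horner_alg a p * y ^+ e).
  rewrite lie_leibniz lie_horner_alg -/y mulrDr.
  rewrite [y * (horner_alg a p * _)]mulrCA [y * lie b _]mulrC lie_expr.
  rewrite [(_ *+ _) * _]mulrC -!mulrA addrK.
  by rewrite !exprS mulrCA.
by apply: rpredB; apply: pidealMr => //; apply: pideal_lier.
Qed.

End RadicalDerivation.

Lemma submod_vspace (K : fieldType) (V : vectType K) (P : V -> Prop) :
    P 0 -> (forall u v, P u -> P v -> P (u + v)) ->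
    (forall c v, P v -> P (c *: v)) ->
  exists U : {vspace V}, forall v, v \in U <-> P v.
Proof.
move=> P0 PD PZ.
(* A subspace of maximal dimension inside P contains every element of P. *)
pose dims n :=
  `[< exists2 U : {vspace V}, \dim U = n & forall v, v \in U -> P v >].
have dims0 : exists n, dims n.
  exists 0%N; apply/asboolP; exists 0%VS; first exact: dimv0.
  by move=> v; rewrite memv0 => /eqP ->.
have dims_max n : dims n -> (n <= \dim {:V})%N.
  by move=> /asboolP[U <- _]; apply/dimvS/subvf.
case: (ex_maxnP dims0 dims_max) => n /asboolP[U dimU UP] n_max.
exists U => v; split=> [/UP // | Pv].
suff /eqP -> : U == (U + <[v]>)%VS by rewrite (subvP (addvSr _ _)) // memv_line.
rewrite eqEdim addvSl dimU; apply/n_max/asboolP; exists (U + <[v]>)%VS => //.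
by move=> _ /memv_addP[u /UP Pu [_ /vlineP[c ->] ->]]; apply: PD => //; apply: PZ.
Qed.

HB.instance Definition _ (K : fieldType) (A : poissonAlgType K) (V : lmodType K)
    (M : poissonModule A V) (a : A) :=
  GRing.isLinear.Build K V V *:%R (pact M a) (pact_linearr M a).
HB.instance Definition _ (K : fieldType) (A : poissonAlgType K) (V : lmodType K)
    (M : poissonModule A V) (a : A) :=
  GRing.isLinear.Build K V V *:%R (pbr M a) (pbr_linearr M a).

Section Annihilator.
Variables (K : fieldType) (A : poissonAlgType K) (V : vectType K).
Variable M : poissonModule A V.
Implicit Types (a b : A) (u v : V) (U : {vspace V}).

Lemma mem_annP a : reflect (forall v, pact M a v = 0) (a \in ann M).
Proof. exact: asboolP. Qed.

Lemma pactZl c a v : pact M (c *: a) v = c *: pact M a v.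
Proof. by have := pact_linearl M v c a 0; rewrite /= pact0l !addr0. Qed.

Lemma pactZr a c v : pact M a (c *: v) = c *: pact M a v.
Proof. exact: linearZ. Qed.

Lemma pact_scalar c v : pact M c%:A v = c *: v.
Proof. by rewrite pactZl pact1. Qed.

Lemma pactBl a b v : pact M (a - b) v = pact M a v - pact M b v.
Proof. by rewrite pactDl pactNl. Qed.

Lemma pact_sum (I : finType) (F : I -> A) v :
  pact M (\sum_i F i) v = \sum_i pact M (F i) v.
Proof.
by apply: (big_morph (fun x => pact M x v)) => [a b|]; rewrite ?pactDl ?pact0l.
Qed.

(** The powers of a act on V by linearly dependent endomorphisms. *)
Lemma ann_algebraic a : exists2 p : {poly K}, p != 0 & horner_alg a p \in ann M.
Proof.
pose W n (i : 'I_n) : 'End(V) := linfun (pact M (a ^+ i)).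
have [k [i0 ki0] k0] := vectors_dependent (@W _) (ltnSn _).
exists (\sum_i k i *: 'X^i).
  apply: contra_neq ki0 => p0; have := congr1 (fun p : {poly K} => p`_i0) p0.
  rewrite coef0 coef_sum (bigD1 i0) //= coefZ coefXn eqxx mulr1.
  rewrite big1 ?addr0 // => i i_neq.
  by rewrite coefZ coefXn eq_sym (inj_eq val_inj) (negPf i_neq) mulr0.
apply/mem_annP => v; have /lfunP/(_ v) := k0; rewrite lfunE /= sum_lfunE => <-.
rewrite linear_sum pact_sum; apply: eq_bigr => i _.
by rewrite linearZ /= mulr_algl rmorphXn /= horner_algX pactZl !lfunE /= lfunE.
Qed.

End Annihilator.

Section Eigenvectors.
Variables (K : numClosedFieldType) (A : poissonAlgType K) (V : vectType K).
Variable M : poissonModule A V.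
Implicit Types (a b : A) (u v : V) (U : {vspace V}).

(** A product of factors a - r kills V, and one of these factors must be
    singular on U. *)
Lemma stable_eigenvector U a : (forall u, u \in U -> pact M a u \in U) ->
  U != 0%VS -> exists c, exists2 u, u \in U /\ u != 0 & pact M a u = c *: u.
Proof.
move=> Ustable U_neq0; have uU := memv_pick U.
have u_neq0 : vpick U != 0 by rewrite vpick0.
have [p p_neq0 /mem_annP p0] := ann_algebraic M a.
have [rs rsE] := closed_field_poly_normal p.
have {p0} : pact M (\prod_(r <- rs) (a - r%:A)) (vpick U) = 0.
  apply/eqP; have /eqP := p0 (vpick U); rewrite rsE linearZ /= mulr_algl.
  by rewrite horner_alg_prod pactZl scaler_eq0 lead_coef_eq0 (negPf p_neq0).
elim: rs {rsE} (vpick U) uU u_neq0 => [|r rs IHrs] u uU u_neq0.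
  by rewrite big_nil pact1 => u0; rewrite u0 eqxx in u_neq0.
rewrite big_cons mulrC pactM.
have [u'0 _|u'_neq0] := eqVneq (pact M (a - r%:A) u) 0.
  exists r, u => //; apply/eqP.
  by rewrite -subr_eq0 -(pact_scalar M) -pactBl u'0.
by apply: IHrs => //; rewrite pactBl pact_scalar rpredB ?rpredZ ?Ustable.
Qed.

(** On a nonzero A-stable subspace U of minimal dimension every a acts by a
    scalar, because the eigenspaces of a in U are again A-stable. *)
Lemma common_weight : (exists v : V, v != 0) ->
  exists chi : A -> K, exists2 u, u != 0 & forall a, pact M a u = chi a *: u.
Proof.
move=> [v v_neq0].
pose stable U := forall a u, u \in U -> pact M a u \in U.
pose dims n := `[< exists2 U, stable U & U != 0%VS /\ \dim U = n >].
have dims_ex : exists n, dims n.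
  exists (\dim {:V}); apply/asboolP; exists fullv.
    by move=> a u _; apply: memvf.
  split=> //; apply: contraNneq v_neq0 => V0.
  by rewrite -memv0 -V0 memvf.
case: (ex_minnP dims_ex) => n /asboolP[U Ustable [U_neq0 dimU]] n_min.
suff /choice[chi chiP] a : exists c, forall u, u \in U -> pact M a u = c *: u.
  exists chi, (vpick U); first by rewrite vpick0.
  by move=> a; apply/chiP/memv_pick.
have [c [u [uU u_neq0] au]] := stable_eigenvector (Ustable a) U_neq0.
exists c; pose E := (U :&: lker (linfun (pact M a) - c *: \1%VF))%VS.
have memE w : (w \in E) = (w \in U) && (pact M a w == c *: w).
  rewrite memv_cap memv_ker add_lfunE opp_lfunE scale_lfunE id_lfunE lfunE.
  by rewrite subr_eq0.
have EU : E = U.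
  apply/eqP; rewrite eqEdim capvSl dimU; apply/n_min/asboolP; exists E; last first.
    split=> //; apply: contraNneq u_neq0 => E0.
    by rewrite -memv0 -E0 memE uU au eqxx.
  move=> b w; rewrite !memE => /andP[wU /eqP aw].
  by rewrite Ustable //= -pactM mulrC pactM aw linearZ.
by move=> w; rewrite -{1}EU memE => /andP[_ /eqP].
Qed.

(** Some power of {b,a} annihilates M, so its eigenvalues vanish. *)
Lemma lie_weight_eq0 (chi : A -> K) u b a : u != 0 ->
  (forall a, pact M a u = chi a *: u) -> chi (lie b a) = 0.
Proof.
move=> u_neq0 chiP; have [p p_neq0 pJ] := ann_algebraic M a.
have [n /mem_annP/(_ u)] := lie_radical b p_neq0 pJ.
suff -> : pact M (lie b a ^+ n) u = chi (lie b a) ^+ n *: u.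
  by move/eqP; rewrite scaler_eq0 (negPf u_neq0) orbF expf_eq0 => /andP[_ /eqP].
elim: n => [|n IHn]; first by rewrite pact1 scale1r.
by rewrite exprSr pactM chiP linearZ /= IHn scalerA exprS.
Qed.

(** The chi-weight space is stable under brackets since
    a.{b,v} = {b,a.v} - {b,a}.v = chi(a) {b,v} - chi({b,a}) v. *)
Lemma simple_scalar : poisson_simple M ->
  exists chi : A -> K, forall a v, pact M a v = chi a *: v.
Proof.
move=> [V_neq0 Msimple]; have [chi [u u_neq0 uP]] := common_weight V_neq0.
exists chi; have [||c v /= Pv a|U /= UP] := @submod_vspace _ V
  (fun v => forall a, pact M a v = chi a *: v).
- by move=> a; rewrite linear0 scaler0.
- by move=> v w /= Pv Pw a; rewrite pactD scalerDr Pv Pw.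
- by rewrite pactZr Pv !scalerA mulrC.
case: (Msimple U) => [b v /UP Pv|b v /UP Pv|U0|UT].
- by apply/UP => a; rewrite !Pv pactZr Pv !scalerA mulrC.
- apply/UP => a; have /eqP := pbr_act M b a v.
  by rewrite !Pv (lie_weight_eq0 b a u_neq0 uP) scale0r add0r linearZ => /eqP <-.
- by move: u_neq0; rewrite -memv0 -U0 => /negP[]; apply/UP.
- by move=> a v; have /UP-> : v \in U by rewrite UT memvf.
Qed.

Lemma simple_splits : poisson_simple M -> splits (ann M).
Proof.
move=> Msimple; have [chi chiP] := simple_scalar Msimple.
have [[v v_neq0] _] := Msimple.
have annE a c : a - c%:A \in ann M <-> c = chi a.
  split=> [/mem_annP/(_ v) | ->]; last first.
    by apply/mem_annP => w; rewrite pactBl chiP pact_scalar subrr.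
  move/eqP; rewrite pactBl chiP pact_scalar -scalerBl scaler_eq0.
  by rewrite (negPf v_neq0) orbF subr_eq0 => /eqP.
by move=> a; exists (chi a); split=> [|c /annE //]; apply/annE.
Qed.

End Eigenvectors.

(** * Splittings A = K + J and maximality *)

Section Splitting.
Variables (K : fieldType) (A : poissonAlgType K) (J : poissonIdeal A).

Lemma splits_proper : splits J -> 1 \notin J.
Proof.
move=> AJ; apply/negP => oneJ; have [c [_ c_uniq]] := AJ 0.
have scalJ d : 0 - d%:A \in J by rewrite sub0r rpredN rpredZ.
have /eqP := etrans (esym (c_uniq 0 (scalJ 0))) (c_uniq 1 (scalJ 1)).
by rewrite eq_sym oner_eq0.
Qed.

Lemma scalar_mem (I : {pred A}) c : ideal I -> 1 \notin I -> c%:A \in I -> c = 0.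
Proof.
move=> [_ _ IM] one_I cI; apply: contraNeq one_I => c_neq0.
have -> : 1 = (c^-1)%:A * c%:A :> A by rewrite mulr_algl scalerA mulVf ?scale1r.
exact: IM.
Qed.

Lemma splits_maximal : splits J -> maximal_ideal J.
Proof.
move=> AJ; split; [by case: (pidealP J) | exact: splits_proper |].
move=> I idI one_I sJI x xI; have [c [xcJ _]] := AJ x.
suff c0 : c = 0 by rewrite c0 scale0r subr0 in xcJ.
apply: (scalar_mem idI one_I); have [_ ID IM] := idI.
have -> : c%:A = x + (-1) * (x - c%:A).
  by rewrite mulN1r opprB addrCA subrr addr0.
by apply: ID => //; apply/IM/sJI.
Qed.

Lemma splits_of_residue : 1 \notin J ->
  (forall x : A, exists c : K, x - c%:A \in J) -> splits J.
Proof.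
move=> oneJ res a; have [c acJ] := res a; exists c; split=> // d adJ.
apply/eqP; rewrite -subr_eq0; apply/eqP; have [idJ _] := pidealP J.
apply: (scalar_mem idJ oneJ).
rewrite (_ : _%:A = (a - d%:A) - (a - c%:A)); first exact: rpredB.
by rewrite scalerBl opprB [RHS]addrC addrA subrK.
Qed.

End Splitting.

(** * Equality and isomorphism of modules *)

Section Extensionality.
Variables (K : fieldType).

Lemma lieModule_ext (L : lieAlgType K) (V : lmodType K) (N N' : lieModule L V) :
  (forall x v, N x v = N' x v) -> N = N'.
Proof.
case: N N' => [f ? ? ?] [f' ? ? ?] /= eq_f.
have ff' : f = f' by apply/funext => x; apply/funext => v; apply: eq_f.
by subst f'; congr LieModule; apply: Prop_irrelevance.
Qed.

Lemma poissonModule_ext (A : poissonAlgType K) (V : lmodType K)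
    (M M' : poissonModule A V) :
    (forall a v, pact M a v = pact M' a v) ->
    (forall a v, pbr M a v = pbr M' a v) -> M = M'.
Proof.
case: M M' => [f b ? ? ? ? ? ? ? ? ?] [f' b' ? ? ? ? ? ? ? ? ?] /= eq_f eq_b.
have ff' : f = f' by apply/funext => x; apply/funext => v; apply: eq_f.
have bb' : b = b' by apply/funext => x; apply/funext => v; apply: eq_b.
by subst f' b'; congr PoissonModule; apply: Prop_irrelevance.
Qed.

Lemma poissonIdeal_ext (A : poissonAlgType K) (J J' : poissonIdeal A) :
  J =i J' -> J = J'.
Proof.
case: J J' => [I HI] [I' HI'] /= eqI.
have II' : I = I' by apply/funext => x; apply: eqI.
by subst I'; congr PoissonIdeal; apply: Prop_irrelevance.
Qed.

End Extensionality.

Section Isomorphisms.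
Variable K : fieldType.

Lemma linear_inverse (V V' : lmodType K) (g : {linear V -> V'}) :
  bijective g -> exists h : {linear V' -> V}, cancel g h /\ cancel h g.
Proof.
move=> [h gK hK].
pose hL : {linear V' -> V} :=
  HB.pack h (GRing.isLinear.Build K V' V *:%R h (can2_linear gK hK)).
by exists hL.
Qed.

Section Lie.
Variable L : lieAlgType K.

Lemma lie_iso_refl (V : lmodType K) (N : lieModule L V) : lie_iso N N.
Proof. by exists idfun; split=> //; exists idfun. Qed.

Lemma lie_iso_sym (V V' : lmodType K) (N : lieModule L V) (N' : lieModule L V') :
  lie_iso N N' -> lie_iso N' N.
Proof.
move=> [g [/linear_inverse[h [gK hK]] gN]]; exists h; split; first by exists g.
by move=> x v; apply: (can_inj gK); rewrite gN !hK.
Qed.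

Lemma lie_iso_trans (V V' V'' : lmodType K) (N : lieModule L V)
    (N' : lieModule L V') (N'' : lieModule L V'') :
  lie_iso N N' -> lie_iso N' N'' -> lie_iso N N''.
Proof.
move=> [g [g_bij gN]] [h [h_bij hN]]; exists (h \o g).
by split=> [|x v]; [apply: bij_comp | rewrite /= gN hN].
Qed.

Lemma lie_class_eq (V V' : vectType K) (N : lieModule L V) (N' : lieModule L V') :
  lie_iso N N' -> lie_class N = lie_class N'.
Proof.
move=> NN'; apply/funext => N''; apply/propext; split; apply: lie_iso_trans => //.
exact: lie_iso_sym.
Qed.

End Lie.

Section Poisson.
Variable A : poissonAlgType K.

Lemma poisson_iso_refl (V : lmodType K) (M : poissonModule A V) : poisson_iso M M.
Proof. by exists idfun; split=> //; exists idfun. Qed.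

Lemma poisson_iso_sym (V V' : lmodType K) (M : poissonModule A V)
    (M' : poissonModule A V') : poisson_iso M M' -> poisson_iso M' M.
Proof.
move=> [g [/linear_inverse[h [gK hK]] gact gbr]]; exists h.
split; first by exists g.
  by move=> a v; apply: (can_inj gK); rewrite gact !hK.
by move=> a v; apply: (can_inj gK); rewrite gbr !hK.
Qed.

Lemma poisson_iso_trans (V V' V'' : lmodType K) (M : poissonModule A V)
    (M' : poissonModule A V') (M'' : poissonModule A V'') :
  poisson_iso M M' -> poisson_iso M' M'' -> poisson_iso M M''.
Proof.
move=> [g [g_bij gact gbr]] [h [h_bij hact hbr]]; exists (h \o g).
by split=> [|a v|a v]; [apply: bij_comp|rewrite /= gact hact|rewrite /= gbr hbr].
Qed.

Lemma class_of_eqP (M M' : fdSimplePoissonModule A) :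
  class_of M = class_of M' <-> poisson_iso M M'.
Proof.
split=> [[eqMM']|MM'].
  by have : poisson_class M M' by rewrite eqMM'; apply: poisson_iso_refl.
apply/eq_exist/funext => M''; apply/propext; split; apply: poisson_iso_trans => //.
exact: poisson_iso_sym.
Qed.

End Poisson.
End Isomorphisms.

Section PairsOfIdealAndModule.
Variables (K : fieldType) (A : poissonAlgType K).
Implicit Types J : poissonIdeal A.

(** Lets modules over J/J^2 and J'/J'^2 be compared before J and J' are known
    to be equal, with no transport along an equation J = J'. *)
Definition intertwines J J' (V V' : lmodType K) (N : lieModule (cotangent J) V)
    (N' : lieModule (cotangent J') V') (g : V -> V') : Prop :=
  forall a (aJ : a \in pideal J) (aJ' : a \in pideal J') v,
    g (N (cotangent_class (IdealElt aJ)) v) =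
    N' (cotangent_class (IdealElt aJ')) (g v).

Lemma intertwinesE J (V V' : lmodType K) (N : lieModule (cotangent J) V)
    (N' : lieModule (cotangent J) V') g :
  intertwines N N' g <-> forall x v, g (N x v) = N' x (g v).
Proof.
split=> [gN x v | gN a aJ aJ' v].
  by rewrite -(cotangent_reprK x); case: (repr x) => a aJ; apply: gN.
by rewrite gN (bool_irrelevance aJ aJ').
Qed.

Lemma existT_lieModule_eq J J' (V : lmodType K) (N : lieModule (cotangent J) V)
    (N' : lieModule (cotangent J') V) : J =i J' -> intertwines N N' id ->
  existT (fun I : poissonIdeal A => lieModule (cotangent I) V) J N
  = existT _ J' N'.
Proof.
move/poissonIdeal_ext=> JJ'; subst J' => /intertwinesE NN'.
by congr existT; apply: lieModule_ext.
Qed.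

Definition lie_pair J (V : vectType K) (N : lieModule (cotangent J) V) :
    {I : poissonIdeal A & fdSimpleLieModule (cotangent I) -> Prop} :=
  existT _ J (lie_class N).

(** From left to right, [compatible] is a property of pairs that holds of the
    pair of N; read on the equal pair of N' it yields an isomorphism from N to
    some module in the class of N'. *)
Lemma lie_pair_eqP J J' (N : fdSimpleLieModule (cotangent J))
    (N' : fdSimpleLieModule (cotangent J')) :
  lie_pair N = lie_pair N' <->
  J =i J' /\ exists2 g : {linear fdslm_space N -> fdslm_space N'},
               bijective g & intertwines N N' g.
Proof.
split=> [eqNN' | [/poissonIdeal_ext JJ']]; last first.
  subst J' => -[g g_bij /intertwinesE gN].
  by congr existT; apply: lie_class_eq; exists g.
pose compatible (p : {I : poissonIdeal A &
                          fdSimpleLieModule (cotangent I) -> Prop}) :=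
  exists2 N1, projT2 p N1 & J =i projT1 p /\
    exists2 g : {linear fdslm_space N -> fdslm_space N1},
      bijective g & intertwines N N1 g.
have : compatible (lie_pair N).
  exists N; first exact: lie_iso_refl.
  by split=> //; exists idfun; [exists idfun | apply/intertwinesE].
rewrite eqNN' => -[N1 /= /lie_iso_sym[h [h_bij hN]] [JJ' [g g_bij gN]]].
split=> //; exists (h \o g); first exact: bij_comp.
by move=> a aJ aJ' v; rewrite /= (gN a aJ aJ') hN.
Qed.

End PairsOfIdealAndModule.

(** * The two constructions are inverse to each other *)

Section DaggerStar.
Variables (K : fieldType) (A : poissonAlgType K).

Lemma mem_projK (J : poissonIdeal A) (AJ : splits J) a :
  a \in J <-> projK AJ a = 0.
Proof.
split=> [aJ | a0]; first by apply: projKP; rewrite scale0r subr0.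
by rewrite (proj_decomp AJ a) a0 scale0r add0r projJ_mem.
Qed.

Lemma projJ_id (J : poissonIdeal A) (AJ : splits J) a (aJ : a \in pideal J) :
  projJ AJ a = IdealElt aJ.
Proof.
by apply: val_inj; rewrite /=; have /mem_projK -> := aJ; rewrite scale0r subr0.
Qed.

Section FromPoisson.
Variables (V : lmodType K) (M : poissonModule A V) (AJ : splits (ann M)).

Lemma pact_projK a v : pact M a v = projK AJ a *: v.
Proof.
rewrite {1}(proj_decomp AJ a) pactDl annP addr0.
have := pact_linearl M v (projK AJ a) 1 0; rewrite /= !addr0 pact0l addr0 => ->.
by rewrite pact1.
Qed.

Lemma pbr_scalar c v : pbr M c%:A v = 0.
Proof.
have pbr1 : pbr M 1 v = 0.
  by apply: (addrI (pbr M 1 v)); rewrite addr0 -[in RHS](mulr1 1) pbrM !pact1.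
by have := pbr_linearl M v c 1 0; rewrite /= !addr0 pbr1 scaler0 pbr0l addr0.
Qed.

Lemma pbr_projJ a v : pbr M a v = pbr M (projJ AJ a : A) v.
Proof. by rewrite {1}(proj_decomp AJ a) pbrDl pbr_scalar add0r. Qed.

Lemma dagger_star : dagger AJ (star M) = M.
Proof.
apply: poissonModule_ext => a v /=; first by rewrite pact_projK.
by rewrite pbr_projJ -starE.
Qed.

End FromPoisson.

Lemma star_simple (V : vectType K) (M : poissonModule A V) : splits (ann M) ->
  poisson_simple M -> lie_simple (star M).
Proof.
move=> AJ [V_neq0 Msimple]; split=> // U Ustable; apply: Msimple => a u uU.
  by rewrite (pact_projK AJ) rpredZ.
by rewrite (pbr_projJ AJ) -starE Ustable.
Qed.

Section FromLie.
Variables (J : poissonIdeal A) (AJ : splits J).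

Lemma dagger_simple (V : vectType K) (N : lieModule (cotangent J) V) :
  lie_simple N -> poisson_simple (dagger AJ N).
Proof.
move=> [V_neq0 Nsimple]; split=> // U _ Ustable; apply: Nsimple => x u uU.
rewrite -(cotangent_reprK x); case: (repr x) => a aJ.
by have := Ustable a u uU; rewrite /= /dagger_br projJ_id.
Qed.

Lemma mem_ann_dagger (V : lmodType K) (N : lieModule (cotangent J) V) :
  (exists v : V, v != 0) -> ann (dagger AJ N) =i J.
Proof.
move=> [v v_neq0] a; apply/asboolP/idP => [aN | /(mem_projK AJ) a0 w].
  apply/(mem_projK AJ)/eqP; have /eqP := aN v.
  by rewrite scaler_eq0 (negPf v_neq0) orbF.
by rewrite /= /dagger_act a0 scale0r.
Qed.

Lemma star_dagger (V : lmodType K) (N : lieModule (cotangent J) V) :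
  (exists v : V, v != 0) ->
  existT (fun I : poissonIdeal A => lieModule (cotangent I) V)
    (ann (dagger AJ N)) (star (dagger AJ N)) = existT _ J N.
Proof.
move=> V_neq0; apply: existT_lieModule_eq; first exact: mem_ann_dagger.
by move=> a aD aJ v; rewrite starE /= /dagger_br projJ_id.
Qed.

Lemma projJ_class_linear : linear (fun a => cotangent_class (projJ AJ a)).
Proof. by move=> c a b; rewrite projJ_linear linearP. Qed.

Definition projJ_class : {linear A -> cotangent J} :=
  HB.pack (fun a => cotangent_class (projJ AJ a))
    (GRing.isLinear.Build K A (cotangent J) *:%R _ projJ_class_linear).

Lemma projJ_class_lie a b :
  projJ_class (lie a b) = lie (projJ_class a) (projJ_class b).
Proof. by rewrite /= projJ_lie lie_cotangent_class. Qed.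

Definition projJ_hom : lieHom A (cotangent J) := LieHom projJ_class_lie.

End FromLie.
End DaggerStar.

Theorem theorem3p4 (R : realType) (A : poissonAlgType R[i]) (hA : affine A) :
  (* (i) *)
  (forall (V : vectType R[i]) (M : poissonModule A V), poisson_simple M ->
     exists Mstar : lieModule (cotangent (ann M)) V,
       lie_simple Mstar /\
       forall (j : ideal_elt (ann M)) (m : V),
         Mstar (cotangent_class j) m = pbr M j m)
  /\
  (* (ii) *)
  (forall J : poissonIdeal A, maximal_ideal J ->
   forall (V : vectType R[i]) (N : lieModule (cotangent J) V), lie_simple N ->
     exists (Ndag : poissonModule A V) (f : lieHom A (cotangent J)),
       [/\ poisson_simple Ndag,
           lie_of_poisson Ndag = lie_pullback f N
         & ann Ndag = J])
  /\
  (* (iii) *)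
  ((forall (V : vectType R[i]) (M : poissonModule A V), poisson_simple M ->
      exists AJ : splits (ann M), dagger AJ (star M) = M)
   /\
   (forall J : poissonIdeal A, maximal_ideal J ->
    forall (V : vectType R[i]) (N : lieModule (cotangent J) V), lie_simple N ->
      exists AJ : splits J,
        existT (fun I : poissonIdeal A => lieModule (cotangent I) V)
          (ann (dagger AJ N)) (star (dagger AJ N)) = existT _ J N))
  /\
  (* (iv) *)
  (exists Gamma : poisson_classes A -> maximal_pairs A,
     (forall M : fdSimplePoissonModule A,
        proj1_sig (Gamma (class_of M)) =
        existT (fun J : poissonIdeal A => fdSimpleLieModule (cotangent J) -> Prop)
          (ann M) (lie_class (star M)))
     /\ bijective Gamma).

Proof.
have Csplits (J : poissonIdeal A) : maximal_ideal J -> splits J.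
  move=> Jmax; have [_ oneJ _] := Jmax; apply: splits_of_residue oneJ _.
  exact: (weak_nullstellensatz (@complex_uncountable R)).
pose fdstar (M : fdSimplePoissonModule A) :
    fdSimpleLieModule (cotangent (ann M)) :=
  FdSimpleLieModule
    (star_simple (simple_splits (fdspm_simple M)) (fdspm_simple M)).
split; [|split; [|split; [split|]]].
- move=> V M Msimple; exists (star M); split; last exact: starE.
  exact: star_simple (simple_splits Msimple) Msimple.
- move=> J /Csplits AJ V N Nsimple; exists (dagger AJ N), (projJ_hom AJ); split.
  + exact: dagger_simple.
  + exact: lieModule_ext.
  + by apply/poissonIdeal_ext/mem_ann_dagger; case: Nsimple.
- by move=> V M /simple_splits AJ; exists AJ; apply: dagger_star.
- by move=> J /Csplits AJ V N [V_neq0 _]; exists AJ; apply: star_dagger.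
have pair_maximal (M : fdSimplePoissonModule A) :
    maximal_ideal (projT1 (lie_pair (fdstar M))) /\
    exists N : fdSimpleLieModule (cotangent (ann M)),
      projT2 (lie_pair (fdstar M)) = lie_class N.
  split; last by exists (fdstar M).
  exact/splits_maximal/simple_splits/fdspm_simple.
pose GammaM M : maximal_pairs A := exist _ (lie_pair (fdstar M)) (pair_maximal M).
have GammaM_eqP M M' : GammaM M = GammaM M' <-> class_of M = class_of M'.
  rewrite class_of_eqP; split.
    move=> /(congr1 (@proj1_sig _ _))/lie_pair_eqP[annMM' [g g_bij gN]].
    pose AJ := simple_splits (fdspm_simple M).
    pose AJ' := simple_splits (fdspm_simple M').
    (* Both splittings have the same ideal, hence the same projections. *)
    have projK_eq a : projK AJ a = projK AJ' a.
      by apply: projKP; rewrite annMM'; apply: projJ_subproof.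
    exists g; split=> // a v.
      by rewrite (pact_projK AJ) (pact_projK AJ') linearZ projK_eq.
    have jM' : (projJ AJ a : A) \in pideal (ann M').
      by have := projJ_mem AJ a; rewrite annMM'.
    rewrite (pbr_projJ AJ) -starE [LHS](gN _ (projJ_subproof AJ a) jM').
    transitivity (pbr M' (projJ AJ a : A) (g v));
      first exact: (starE (IdealElt jM')).
    by rewrite [RHS](pbr_projJ AJ') /= projK_eq.
  move=> [g [g_bij gact gbr]]; apply/eq_exist/lie_pair_eqP; split.
    move=> a; apply/asboolP/asboolP => aM v; last first.
      by apply: (bij_inj g_bij); rewrite gact aM linear0.
    by have [h _ hK] := g_bij; rewrite -(hK v) -gact aM linear0.
  exists g => // a aJ aJ' v; rewrite [X in g X](starE (IdealElt aJ)) gbr;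
    symmetry; exact: (starE (IdealElt aJ')).
(* Gamma is computed on a chosen representative of the class. *)
pose rep (c : poisson_classes A) := projT1 (cid (proj2_sig c)).
have repK c : class_of (rep c) = c.
  by case: c => c c_class; apply/eq_exist; rewrite /rep /=; case: cid => M /= ->.
exists (fun c => GammaM (rep c)); split=> [M|].
  by rewrite (_ : GammaM _ = GammaM M) //; apply/GammaM_eqP/repK.
have /choice[h hP] (p : maximal_pairs A) : exists M, GammaM M = p.
  case: p => -[J cN] [/= Jmax [N cNE]]; subst cN; have AJ := Csplits J Jmax.
  exists (FdSimplePoissonModule (dagger_simple AJ (fdslm_simple N))).
  apply/eq_exist; have [V_neq0 _] := fdslm_simple N.
  exact: (congr1 (fun p : {I : poissonIdeal A &
    lieModule (cotangent I) (fdslm_space N)} => lie_pair (projT2 p))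
    (star_dagger AJ (fdslm_module N) V_neq0)).
exists (fun p => class_of (h p)) => [c | p].
  by rewrite -[RHS]repK; apply/GammaM_eqP/hP.
by rewrite -[RHS]hP; apply/GammaM_eqP/repK.
Qed.
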